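(* For every $\alpha\in(0,1/32)$ there exist $\varepsilon>0$ and $n_0$ such that if $D$ is a directed graph on $2n\ge 2n_0$ vertices, $D$ is not $\alpha$-extremal, and $\delta^0(D)\ge(1-\varepsilon)n$, then $D$ contains an anti-directed Hamiltonian cycle.
   Context: Directed graphs are loopless, with $E(D)\subseteq V(D)\times V(D)$; $\delta^0(D)$ is the minimum of the minimum out-degree and the minimum in-degree. $\Delta^+(A,B)=\max_{a\in A}|N^+(a)\cap B|$ and $\Delta^-(B,A)=\max_{b\in B}|N^-(b)\cap A|$. A directed graph $D$ on $2n$ vertices is $\alpha$-extremal if there exist $A,B\subseteq V(D)$ with $(1-\alpha)n\le|A|,|B|\le(1+\alpha)n$, $\Delta^+(A,B)\le\alpha n$ and $\Delta^-(B,A)\le\alpha n$. An anti-directed Hamiltonian cycle is a spanning subgraph whose underlying graph is a cycle and in which no two consecutive edges form a directed path. *)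

(* Defs.v *)
From HB Require Import structures.
From mathcomp Require Import all_boot all_order all_algebra.
From mathcomp Require Import reals.

Set Implicit Arguments.
Unset Strict Implicit.
Unset Printing Implicit Defensive.

Import Order.TTheory GRing.Theory Num.Theory.

(* A directed graph is a finite vertex type T with an edge relation E,
   E x y meaning (x, y) is an edge; looplessness is [irreflexive E].  Both
   (x, y) and (y, x) may be edges. *)
Section Digraph.
Variables (T : finType) (E : rel T).

Definition out_nbhd (x : T) : {set T} := [set y | E x y].
Definition in_nbhd (x : T) : {set T} := [set y | E y x].

(* The default value #|T| bounds every degree, so on a nonempty T these are
   the actual minima. *)
Definition min_outdeg : nat := \big[minn/#|T|]_(x : T) #|out_nbhd x|.
Definition min_indeg : nat := \big[minn/#|T|]_(x : T) #|in_nbhd x|.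
Definition min_semideg : nat := minn min_outdeg min_indeg.

Definition max_outdeg (A B : {set T}) : nat :=
  \max_(a in A) #|out_nbhd a :&: B|.
Definition max_indeg (B A : {set T}) : nat :=
  \max_(b in B) #|in_nbhd b :&: A|.

(* Meant for #|T| = 2 * n. *)
Definition extremal (R : realType) (alpha : R) (n : nat) : Prop :=
  exists A B : {set T},
    [/\ ((1 - alpha) * n%:R <= #|A|%:R <= (1 + alpha) * n%:R)%R,
        ((1 - alpha) * n%:R <= #|B|%:R <= (1 + alpha) * n%:R)%R,
        ((max_outdeg A B)%:R <= alpha * n%:R)%R
      & ((max_indeg B A)%:R <= alpha * n%:R)%R].

(* H is a set of edges on the whole vertex set T whose underlying graph is a
   Hamiltonian cycle: listing the vertices in cyclic order as c, the adjacent
   pairs are exactly the cyclically consecutive ones, and each of them carries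
   exactly one edge of H (no pair of opposite edges). *)
Definition underlying_hamiltonian_cycle (H : rel T) : Prop :=
  (exists c : seq T,
    [/\ uniq c, forall x, x \in c, 2 < size c
      & forall x y, (H x y || H y x) = (next c x == y) || (next c y == x)])
  /\ (forall x y, H x y -> ~~ H y x).

Definition no_directed_2path (H : rel T) : Prop :=
  forall x y z, x != z -> ~~ (H x y && H y z).

Definition has_antidirected_hamiltonian_cycle : Prop :=
  exists H : rel T,
    [/\ subrel H E, underlying_hamiltonian_cycle H & no_directed_2path H].

End Digraph.

(* Main.v *)
(** Split the vertex set into halves S and ~: S such that every neighbourhood,
    every difference of two out-neighbourhoods and every class of near-twins
    is split almost evenly; an exponential potential averaged over all splits
    shows that one exists.  Vertices of S will be sources and the others
    sinks, so an anti-directed Hamiltonian cycle is a Hamiltonian cycle of the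
    bipartite graph of edges from S to ~: S.  Degrees there are about n/2, and
    non-extremality of the digraph makes any two sets of about n/2 sources and
    n/2 sinks span quadratically many edges.

    For a cyclic list of vertices alternating between the sides, call a
    consecutive nonadjacent pair a break.  A short balanced segment between
    two breaks can be cut out and reinserted: if its ends are adjacent to a
    and b, density yields such a and b whose successors are adjacent, and a
    Pósa rotation inserts the segment there without creating breaks.  So some
    list has boundedly many breaks.  These are closed by edges of a small
    matching, reserved greedily in advance, that contains many connections
    for every source-sink pair; the unused edges of the matching are inserted
    by the same rotation. *)
Require Import Defs.
From HB Require Import structures.
From mathcomp Require Import all_boot all_order all_algebra.
From mathcomp Require Import reals.
From mathcomp Require Import zify ring lra.

Set Implicit Arguments.
Unset Strict Implicit.
Unset Printing Implicit Defensive.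

Import Order.TTheory GRing.Theory Num.Theory.

(** * Breaks of cyclic lists *)

Section Breaks.
Variables (T : eqType) (r : rel T).

Fixpoint breaks (x : T) (p : seq T) : nat :=
  if p is y :: p' then ~~ r x y + breaks y p' else 0.

Definition cbreaks (s : seq T) : nat :=
  if s is x :: p then breaks x (rcons p x) else 0.

Lemma breaks_cat x p1 p2 :
  breaks x (p1 ++ p2) = breaks x p1 + breaks (last x p1) p2.
Proof. by elim: p1 x => //= y p IH x; rewrite IH addnA. Qed.

Lemma cbreaks_cons x p : cbreaks (x :: p) = breaks x p + ~~ r (last x p) x.
Proof. by rewrite /cbreaks -cats1 breaks_cat /= addn0. Qed.

Lemma breaks_eq0 x p : (breaks x p == 0) = path r x p.
Proof. by elim: p x => //= y p IH x; rewrite addn_eq0 IH eqb0 negbK. Qed.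

Lemma cbreaks_eq0 s : (cbreaks s == 0) = cycle r s.
Proof. by case: s => //= x p; rewrite breaks_eq0. Qed.

Lemma cbreaks_cat x p y q :
  cbreaks ((x :: p) ++ y :: q) =
  breaks x p + ~~ r (last x p) y + breaks y q + ~~ r (last y q) x.
Proof.
by rewrite cat_cons cbreaks_cons breaks_cat last_cat /= !addnA.
Qed.

Lemma cbreaks_rot n s : cbreaks (rot n s) = cbreaks s.
Proof.
rewrite /rot -{3}(cat_take_drop n s).
case: (take n s) (drop n s) => [|x p] [|y q]; rewrite ?cats0 ?cat0s //.
by rewrite !cbreaks_cat; lia.
Qed.

Hypothesis r_sym : symmetric r.

Lemma breaks_rev x p :
  exists y q, [/\ rev (x :: p) = y :: q, y = last x p, last y q = x
                & breaks y q = breaks x p].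
Proof.
elim: p x => [|z p IH] x; first by exists x, [::].
have [y [q [E1 E2 E3 E4]]] := IH z.
exists y, (rcons q x); rewrite rev_cons E1 rcons_cons last_rcons.
split=> //; rewrite -cats1 breaks_cat E3 E4 /= addn0 addnC; congr (_ + _).
by rewrite r_sym.
Qed.

(* Pósa-type insertion of the segment [u .. w] into the cyclic list
   A ++ B = [a' .. a] ++ [b' .. b]: the result [a' .. a u .. w b .. b'] trades
   the gaps (a, b') and (b, a') for the gaps (a, u), (w, b) and (b', a'). *)
Lemma cbreaks_insert a' p b' q u m :
  r (last a' p) u -> r (last u m) (last b' q) -> r b' a' ->
  cbreaks ((a' :: p) ++ (u :: m) ++ rev (b' :: q))
    <= cbreaks ((a' :: p) ++ b' :: q) + breaks u m.
Proof.
move=> au wb ba; have [b [q' [-> Eb El Er]]] := breaks_rev b' q.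
rewrite cbreaks_cat cat_cons cbreaks_cat breaks_cat last_cat /= Er -Eb El.
by rewrite Eb wb au ba; lia.
Qed.

End Breaks.

Lemma rcons_headP (T : eqType) (s : seq T) (x : T) :
  exists y p, rcons s x = y :: p /\ last y p = x.
Proof.
by case: s => [|y p]; [exists x, [::] | exists y, (rcons p x); rewrite last_rcons].
Qed.

(** [L'] is chosen before [r], so the same list controls both the breaks of [e] and the alternation
    between the sides. *)
Lemma insert_segment (T : eqType) (e : rel T) (L : seq T) (a b u : T) (m : seq T) :
  uniq L -> a \in L -> b \in L -> a != b ->
  e a u -> e (last u m) b -> e (next L a) (next L b) ->
  exists L', perm_eq L' (L ++ u :: m) /\
    forall r : rel T, symmetric r -> subrel e r ->
      cbreaks r L' <= cbreaks r L + breaks r u m.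
Proof.
move=> uL aL bL ab eau eub enn.
(* Rotating [b] to the end cuts the cycle into two pieces ending in [a] and [b]; each piece begins
   with the successor of the end of the other. *)
have [i [p1 [p2 EL]]] : exists i p1 p2, rot i L = rcons p1 a ++ rcons p2 b.
  case/splitPr: bL uL aL => s1 s2 uL aL.
  have as21 : a \in s2 ++ s1.
    by move: aL; rewrite !mem_cat inE (negPf ab) /= orbC.
  case/splitPr E: {1}(s2 ++ s1) / as21 => [q1 q2].
  exists (size s1).+1, q1, q2.
  by rewrite -cat_rcons -(size_rcons s1 b) rot_size_cat -cats1 catA E -!cats1 -!catA.
have [a' [p [EA laA]]] := rcons_headP p1 a.
have [b' [q [EB lbB]]] := rcons_headP p2 b.
have nb : next L b = a'.
  rewrite -(next_rot i uL) EL -(next_rotr 1) -?EL ?rot_uniq // EL.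
  by rewrite -rcons_cat rotr1_rcons EA /= eqxx.
have na : next L a = b'.
  rewrite -(next_rot i uL) EL -(next_rot (size p1)) -?EL ?rot_uniq // EL.
  by rewrite -cats1 -catA rot_size_cat EB /= eqxx.
exists ((a' :: p) ++ (u :: m) ++ rev (b' :: q)); split.
  rewrite -EA -EB perm_catCA perm_sym perm_catC perm_cat2l -(perm_rot i) EL.
  by rewrite perm_cat2l perm_sym perm_rev.
move=> r rsym sub; rewrite -(cbreaks_rot r i L) EL EA EB.
apply: cbreaks_insert => //; apply: sub; rewrite ?laA ?lbB //.
by rewrite -na -nb.
Qed.

Lemma breaks_sum (T : eqType) (r : rel T) (x0 x : T) (p : seq T) :
  breaks r x p = \sum_(i < size p) ~~ r (nth x0 (x :: p) i) (nth x0 p i).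
Proof.
elim: p x => [|y p IH] x /=; first by rewrite big_ord0.
by rewrite big_ord_recl IH.
Qed.

(** Break indices are sorted by parity and by block of [l] positions; two in one class enclose an
    even number of vertices, fewer than [l]. The extra 1 pays for the closing gap, which is not
    indexed. *)
Lemma close_breaks (T : eqType) (r : rel T) (L : seq T) (l : nat) :
  0 < l -> 2 * (size L %/ l).+1 + 1 < cbreaks r L ->
  exists i u m c d, [/\ rot i L = (u :: m) ++ c :: d, size m < l, odd (size m),
    ~~ r (last u m) c & ~~ r (last c d) u].
Proof.
case: L => [|x p] l0; first by rewrite addn1.
rewrite cbreaks_cons => many; set L := x :: p.
pose A := [set i : 'I_(size p) | ~~ r (nth x L i) (nth x p i)].
have cardA : #|A| = breaks r x p.
  rewrite (breaks_sum r x) -sum1_card big_mkcond /=; apply: eq_bigr => i _.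
  by rewrite inE; case: (r _ _).
pose f (i : 'I_(size p)) := (inord (i %/ l) : 'I_(size L %/ l).+1, odd i).
have [inj|/dinjectivePn[i iA [j]]] := boolP (dinjectiveb f (mem A)).
  have {}inj : {in A &, injective f} by move=> a b; apply: (dinjectiveP _ _ inj).
  have := max_card (mem (f @: A)).
  rewrite card_in_imset // card_prod card_ord card_bool cardA; move: many.
  by case: (~~ _) => /=; lia.
move: iA; rewrite !inE => iA /andP[ji jA] [/(congr1 val)].
have ord_ok (k : 'I_(size p)) : k %/ l < (size L %/ l).+1.
  by rewrite ltnS leq_div2r //= (leq_trans (ltnW (ltn_ord k))).
rewrite /= !inordK ?ord_ok // => qij oij.
wlog lij : i j iA jA ji qij oij / i < j.
  move=> W; have [lij|lji|/val_inj eij] := ltngtP i j; first exact: (W i j).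
    by apply: (W j i jA iA _ (esym qij) (esym oij) lji); rewrite eq_sym.
  by rewrite eij eqxx in ji.
have jp := ltn_ord j; have ip := ltn_ord i.
have dl : j - i < l.
  have := divn_eq i l; have := divn_eq j l; rewrite qij.
  by have := ltn_pmod j l0; lia.
have ev : odd (j - i) = false by rewrite oddB ?(ltnW lij) // oij addbb.
have Ei : take i.+1 L = rcons (take i L) (nth x L i).
  by rewrite (take_nth x) //= (leq_trans ip).
have [m Em] : exists m, take (j - i) (drop i.+1 L) = nth x p i :: m.
  rewrite (drop_nth x) /= ?ltnS //.
  by case E: (j - i) => [|k]; [lia | exists (take k (drop i.+1 p))].
have Edj : drop (j - i) (drop i.+1 L) = nth x p j :: drop j.+1 p.
  rewrite drop_drop (_ : j - i + i.+1 = j.+1); last by lia.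
  by rewrite (drop_nth x) //= ltnS.
have szm : (size m).+1 = j - i.
  have /(congr1 size) := Em; rewrite size_takel // size_drop /L /=; lia.
exists i.+1, (nth x p i), m, (nth x p j), (drop j.+1 p ++ take i.+1 L); split.
- by rewrite /rot -{1}(cat_take_drop (j - i) (drop i.+1 L)) Em Edj -catA.
- by lia.
- by move: ev; rewrite -szm /= => /negbFE.
- suff -> : last (nth x p i) m = nth x L j by [].
  rewrite (last_nth x) -Em nth_take ?szm; last by lia.
  rewrite nth_drop; congr nth; lia.
- by rewrite last_cat Ei last_rcons.
Qed.

(** * Hamiltonian cycles in dense bipartite graphs *)

Section Bipartite.
Variables (T : finType) (S : {set T}) (e : rel T).
Hypothesis e_sym : symmetric e.

Definition across : rel T := fun x y => (x \in S) != (y \in S).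

Hypothesis e_across : subrel e across.

Lemma across_sym : symmetric across.
Proof. by move=> x y; rewrite /across eq_sym. Qed.

Lemma path_across_last x p :
  path across x p -> (last x p \in S) = (x \in S) (+) odd (size p).
Proof.
elim: p x => [|y p IH] x /=; first by rewrite addbF.
by move=> /andP[xy /IH->]; move: xy; rewrite /across; do 2!case: (_ \in S); case: odd.
Qed.

Definition nbhd (x : T) : {set T} := [set y | e x y].

Variable kappa : nat.

Hypothesis e_dense : forall X Y : {set T},
  X \subset S -> Y \subset ~: S -> kappa <= #|X| -> kappa <= #|Y| ->
  exists x y, [/\ x \in X, y \in Y & e x y].

Lemma edge_across (X Y : {set T}) (c : bool) :
  {in X, forall x, (x \in S) = c} -> {in Y, forall y, (y \in S) = ~~ c} ->
  kappa <= #|X| -> kappa <= #|Y| -> exists x y, [/\ x \in X, y \in Y & e x y].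
Proof.
case: c => hX hY kX kY.
  apply: e_dense => //; apply/subsetP=> z; first by move/hX->.
  by move/hY; rewrite inE => ->.
have [||y [x [yY xX yx]]] := e_dense _ _ kY kX; last by exists x, y; rewrite e_sym.
  by apply/subsetP=> z; move/hY->.
by apply/subsetP=> z; move/hX; rewrite inE => ->.
Qed.

(** Successors of neighbours of [u] lie on the side of [u], those of neighbours of [last u m] on the
    other side. As [next] is injective, there are enough of both for density to give the edge
    between successors that the insertion needs. *)
Lemma absorb_segment (L : seq T) (u : T) (m : seq T) :
  uniq L -> cycle across L -> across u (last u m) ->
  kappa <= #|nbhd u :&: [set x in L]| ->
  kappa <= #|nbhd (last u m) :&: [set x in L]| ->
  exists L', perm_eq L' (L ++ u :: m) /\
    forall r : rel T, symmetric r -> subrel e r ->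
      cbreaks r L' <= cbreaks r L + breaks r u m.
Proof.
move=> uL cL auw ku kw.
have nexti : injective (next L) := can_inj (prev_next uL).
pose X := next L @: (nbhd u :&: [set x in L]).
pose Y := next L @: (nbhd (last u m) :&: [set x in L]).
have side (v : T) : {in next L @: (nbhd v :&: [set x in L]),
    forall x, (x \in S) = (v \in S)}.
  move=> _ /imsetP[a /[!inE] /andP[/e_across va aL] ->].
  move: va (next_cycle cL aL); rewrite /across.
  by do 3!case: (_ \in S).
have [|||| x [y []]] := @edge_across X Y (u \in S).
- exact: side.
- by move=> y /side->; move: auw; rewrite /across; do 2!case: (_ \in S).
- by rewrite card_imset.
- by rewrite card_imset.
move=> /imsetP[a /[!inE] /andP[ua aL] ->] /imsetP[b /[!inE] /andP[wb bL] ->] nab.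
apply: (@insert_segment _ e L a b) => //; last by rewrite e_sym.
apply/eqP=> ab; move: (e_across ua) (e_across wb) auw; rewrite ab /across.
by do 3!case: (_ \in S).
Qed.

(* By pigeonhole two breaks of the same parity are less than l apart; the
   segment between them is balanced and short. *)
Lemma reduce_breaks (L : seq T) (l : nat) :
  uniq L -> cycle across L -> 0 < l ->
  (forall x, kappa + l <= #|nbhd x :&: [set y in L]|) ->
  2 * (size L %/ l).+1 + 1 < cbreaks e L ->
  exists L', [/\ perm_eq L' L, cycle across L' & cbreaks e L' < cbreaks e L].
Proof.
move=> uL cL l0 deg many.
have [i [u [m [c [d [Erot sm om mc du]]]]]] := close_breaks l0 many.
have permL : perm_eq ((u :: m) ++ c :: d) L by rewrite -Erot perm_rot.
have uumcd : uniq ((u :: m) ++ c :: d) by rewrite (perm_uniq permL).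
have ccd : cbreaks across ((u :: m) ++ c :: d) = 0.
  by apply/eqP; rewrite -Erot cbreaks_rot cbreaks_eq0.
move: ccd; rewrite cbreaks_cat => /eqP.
rewrite !addn_eq0 !breaks_eq0 !eqb0 !negbK => /andP[/andP[/andP[pm amc] pd] adu].
have uw : across u (last u m).
  by rewrite /across (path_across_last pm) om addbT; case: (_ \in S).
have cyc : cycle across (c :: d).
  rewrite -cbreaks_eq0 cbreaks_cons addn_eq0 breaks_eq0 pd eqb0 negbK.
  by move: uw amc adu; rewrite /across; do 4!case: (_ \in S).
(* The segment has at most [l] vertices, so cutting it out costs at most [l] neighbours. *)
have deg' v : kappa <= #|nbhd v :&: [set x in c :: d]|.
  rewrite -(leq_add2r l); apply: leq_trans (deg v) _.
  apply: leq_trans (_ : #|(nbhd v :&: [set x in c :: d]) :|: [set x in u :: m]| <= _).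
    apply/subset_leq_card/subsetP => x; rewrite !in_setU !in_setI !in_set.
    by rewrite -(perm_mem permL) mem_cat; case: (e v x); rewrite //= orbC.
  rewrite cardsU (leq_trans (leq_subr _ _)) // leq_add2l.
  by rewrite cardsE (leq_trans (card_size _)).
have ucd : uniq (c :: d) by move: uumcd; rewrite cat_uniq => /and3P[].
have [L' [pL' hL']] := absorb_segment ucd cyc uw (deg' _) (deg' _).
exists L'; split.
- by apply: perm_trans pL' _; rewrite perm_catC.
- have := hL' _ across_sym e_across.
  move: cyc; rewrite -cbreaks_eq0 => /eqP->.
  by move: pm; rewrite -breaks_eq0 => /eqP->; rewrite leqn0 cbreaks_eq0.
(* The cut removes two breaks, and closing up [c :: d] adds at most one. *)
- apply: leq_ltn_trans (hL' e e_sym _) _ => //.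
  rewrite -(cbreaks_rot e i L) Erot cbreaks_cat cbreaks_cons mc du /=.
  move: (leq_b1 (~~ e (last c d) c)); move: (nat_of_bool _) => b.
  by move: (breaks e c d) (breaks e u m) => a a'; clear; lia.
Qed.

Lemma few_breaks (L : seq T) (l : nat) :
  uniq L -> cycle across L -> 0 < l ->
  (forall x, kappa + l <= #|nbhd x :&: [set y in L]|) ->
  exists L', [/\ perm_eq L' L, cycle across L'
    & cbreaks e L' <= 2 * (size L %/ l).+1 + 1].
Proof.
move=> uL cL l0 deg; have [k] := ubnP (cbreaks e L).
elim: k L uL cL deg => // k IH L uL cL deg /ltnSE lek.
have [le|many] := leqP (cbreaks e L) (2 * (size L %/ l).+1 + 1); first by exists L.
have [L1 [p1 c1 b1]] := reduce_breaks uL cL l0 deg many.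
have [||||L2 [p2 c2 b2]] := IH L1.
- by rewrite (perm_uniq p1).
- by [].
- move=> x; rewrite (_ : [set y in L1] = [set y in L]) //.
  by apply/setP=> y; rewrite !inE (perm_mem p1).
- exact: leq_trans b1 lek.
by exists L2; rewrite -(perm_size p1); split=> //; apply: perm_trans p2 p1.
Qed.

End Bipartite.

(** * Closing the remaining breaks with reserved edges *)

Section Connect.
Variables (T : finType) (S : {set T}) (e : rel T).
Hypothesis e_sym : symmetric e.
Hypothesis e_across : subrel e (across S).

Definition source_sink_edge (m : T * T) := [&& m.1 \in S, m.2 \notin S & e m.1 m.2].

Definition flat (M : seq (T * T)) : seq T :=
  flatten [seq [:: m.1; m.2] | m <- M].

(* m = (x, y) can be used to join s and t through s - y - x - t. *)
Definition links (s t : T) (m : T * T) := e t m.1 && e s m.2.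

Lemma perm_flat M M' : perm_eq M M' -> perm_eq (flat M) (flat M').
Proof. by move=> p; apply/perm_flatten/perm_map. Qed.

Lemma breaksP x p : 0 < breaks e x p ->
  exists p1 y p2, p = p1 ++ y :: p2 /\ ~~ e (last x p1) y.
Proof.
elim: p x => //= y p IH x; have [xy|xy _] := boolP (e x y).
  by rewrite add0n => /IH[p1 [z [p2 [-> h]]]]; exists (y :: p1), z, p2.
by exists [::], y, p.
Qed.

Lemma rot_to_break (L : seq T) : 0 < cbreaks e L ->
  exists i x p, rot i L = x :: p /\ ~~ e (last x p) x.
Proof.
case: L => // x p; rewrite cbreaks_cons.
have [b0|bp _] := posnP (breaks e x p).
  by rewrite b0 add0n lt0b => h; exists 0, x, p; rewrite rot0.
have [p1 [y [p2 [-> h]]]] := breaksP bp.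
exists (size (x :: p1)), y, (p2 ++ x :: p1); split; last by rewrite last_cat.
by rewrite -cat_cons rot_size_cat.
Qed.

(** Each break is bridged through a link. This costs every pair at most one link and removes one
    break, so the supply lasts. Keeping the vertices of [L] preserves degrees into the list for the
    later insertions. *)
Lemma connect_breaks (L : seq T) (M : seq (T * T)) :
  cycle (across S) L -> all source_sink_edge M ->
  (forall s t, s \in S -> t \notin S -> cbreaks e L <= count (links s t) M) ->
  exists L' M', [/\ perm_eq (L' ++ flat M') (L ++ flat M), cycle e L',
    {subset M' <= M} & {subset L <= L'}].
Proof.
have [k] := ubnP (cbreaks e L); elim: k L M => // k IH L M /ltnSE lek cL aM cnt.
have [b0|bp] := posnP (cbreaks e L).
  by exists L, M; split=> //; rewrite -cbreaks_eq0 b0.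
have [i [x [p [Erot xp]]]] := rot_to_break bp.
have cxp : cycle (across S) (x :: p) by rewrite -Erot rot_cycle.
have alx : across S (last x p) x.
  by move: cxp; rewrite /= rcons_path => /andP[].
have pL : perm_eq (x :: p) L by rewrite -Erot perm_rot.
have bL : cbreaks e L = breaks e x p + 1.
  by rewrite -(cbreaks_rot e i) Erot cbreaks_cons xp.
have [m [c [c' [mM pm lc cc c'x]]]] : exists m c c',
    [/\ m \in M, perm_eq [:: c; c'] [:: m.1; m.2], e (last x p) c, e c c' & e c' x].
  have some s t : s \in S -> t \notin S -> exists2 m, m \in M & links s t m.
    by move=> sS tS; apply/hasP; rewrite has_count (leq_trans bp) ?cnt.
  (* The source of the gap plays [s] and the sink plays [t]; the detour starts with the end of [m]
     on the side of [x]. *)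
  case: (boolP (x \in S)) alx => xS; rewrite /across ?xS ?(negPf xS).
    move=> lS; have [|m mM /andP[e1 e2]] := some _ (last x p) xS.
      by move: lS; case: (_ \in S).
    have /and3P[_ _ em] := allP aM _ mM.
    by exists m, m.1, m.2; split; rewrite ?perm_refl // e_sym.
  move=> lS; have [|m mM /andP[e1 e2]] := some (last x p) x _ xS.
    by move: lS; case: (_ \in S).
  have /and3P[_ _ em] := allP aM _ mM.
  exists m, m.2, m.1; split; rewrite // ?(e_sym m.2) // ?(e_sym m.1) //.
  by rewrite -[[:: m.2; m.1]]/([:: m.2] ++ [:: m.1]) perm_catC.
have nb : cbreaks e (x :: p ++ [:: c; c']) < cbreaks e L.
  rewrite bL cbreaks_cons breaks_cat last_cat /= lc cc c'x /= !addn0.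
  by rewrite addn1.
have pM : perm_eq M (m :: rem m M) by apply: perm_to_rem.
have [|||s t sS tS|L' [M' [pL' cL' sM sL]]] := IH (x :: p ++ [:: c; c']) (rem m M).
- exact: leq_trans nb lek.
- move: cxp; rewrite /= !rcons_path cat_path last_cat /= => /andP[-> _].
  by rewrite !e_across.
- by apply/allP=> z /mem_rem/(allP aM).
- have := cnt s t sS tS; rewrite (permP pM) -cat1s count_cat /= addn0; move: nb => /=.
  by move: (leq_b1 (links s t m)); clear; lia.
exists L', M'; split=> //.
- rewrite (perm_trans pL') // -cat_cons -catA.
  apply: perm_cat => //; apply: (@perm_trans _ ([:: m.1; m.2] ++ flat (rem m M))).
    by rewrite perm_cat2r.
  by rewrite perm_sym (perm_flat pM).
- by move=> z /sM/mem_rem.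
- by move=> z zL; apply: sL; rewrite -cat_cons mem_cat (perm_mem pL) zL.
Qed.

Variable kappa : nat.
Hypothesis e_dense : forall X Y : {set T},
  X \subset S -> Y \subset ~: S -> kappa <= #|X| -> kappa <= #|Y| ->
  exists x y, [/\ x \in X, y \in Y & e x y].

(** A reserved edge is a two-vertex segment without breaks, so inserting it keeps a cycle of [e],
    and degrees into the list only grow. *)
Lemma absorb_edges (L : seq T) (M : seq (T * T)) :
  uniq (L ++ flat M) -> cycle e L -> all source_sink_edge M ->
  (forall x, kappa <= #|nbhd e x :&: [set y in L]|) ->
  exists L', perm_eq L' (L ++ flat M) /\ cycle e L'.
Proof.
elim: M L => [|m M IH] L uLM cL; first by exists L; rewrite cats0.
move=> /= /andP[/and3P[m1 m2 em] aM] deg.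
have uL : uniq L by move: uLM; rewrite cat_uniq => /andP[].
have cLa : cycle (across S) L by case: L cL {uL uLM deg} => //= x p; apply: sub_path.
have acr : across S m.1 (last m.1 [:: m.2]) by rewrite /= e_across.
have [L1 [p1 h1]] :=
  absorb_segment e_sym e_across e_dense uL cLa acr (deg m.1) (deg _).
have pL1 : perm_eq (L1 ++ flat M) (L ++ flat (m :: M)).
  by rewrite -[flat (m :: M)]/([:: m.1; m.2] ++ flat M) catA perm_cat2r.
have [|||x|L2 [p2 c2]] := IH L1.
- by rewrite (perm_uniq pL1).
- move: cL (h1 e e_sym (fun _ _ => id)); rewrite -!cbreaks_eq0 => /eqP->.
  by rewrite add0n [breaks _ _ _]/= em leqn0.
- by [].
- apply: leq_trans (deg x) _; apply/subset_leq_card/setIS/subsetP => y.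
  by rewrite !inE (perm_mem p1) mem_cat => ->.
by exists L2; split=> //; apply: perm_trans p2 pL1.
Qed.

End Connect.

(** * From a bipartite cycle to an anti-directed one *)

(** Directing every edge of the cycle out of [S] makes each vertex only a source or only a sink, so
    neither opposite edges nor directed 2-paths arise. *)
Lemma antidirected_of_cycle (T : finType) (S : {set T}) (E : rel T)
    (e : rel T) (L : seq T) :
  subrel e (across S) -> (forall x y, x \in S -> e x y -> E x y) ->
  symmetric e -> uniq L -> (forall x, x \in L) -> 2 < size L -> cycle e L ->
  has_antidirected_hamiltonian_cycle E.
Proof.
move=> eac eE esym uL allL szL cL.
have enext x : e x (next L x) by apply: next_cycle.
pose H x y := (x \in S) && ((next L x == y) || (next L y == x)).
have He x y : H x y -> e x y.
  by case/andP=> _ /orP[] /eqP <- //; rewrite esym.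
have HS x y : H x y -> (x \in S) && (y \notin S).
  move=> Hxy; case/andP: (Hxy) => xS _; rewrite xS.
  by move/He/eac: Hxy; rewrite /across xS; case: (_ \in S).
exists H; split.
- by move=> x y Hxy; apply: eE (He _ _ Hxy); case/andP: Hxy.
- split; last first.
    move=> x y /HS/andP[_ yS]; apply/negP => /HS/andP[].
    by rewrite (negPf yS).
  exists L; split=> // x y; rewrite /H [(next L y == x) || _]orbC -andb_orl.
  have [nxy /=|//] := boolP ((next L x == y) || _); rewrite ?andbF // andbT.
  have : across S x y.
    apply: eac; case/orP: nxy => /eqP <- //; by rewrite esym.
  by rewrite /across; do 2!case: (_ \in S).
- move=> x y z _; apply/negP=> /andP[/HS/andP[_ yS] /HS/andP[]].
  by rewrite (negPf yS).
Qed.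

(** * Growth estimates for powers *)

Section Growth.
Local Open Scope ring_scope.

Lemma bernoulli (R : realFieldType) (c : R) k :
  -1 <= c -> 1 + k%:R * c <= (1 + c) ^+ k.
Proof.
move=> c1; elim: k => [|k IH]; first by rewrite mul0r addr0 expr0.
rewrite exprS -natr1; have c0 : 0 <= 1 + c by lra.
apply: le_trans (ler_wpM2l c0 IH).
have := sqr_ge0 c; have : 0 <= k%:R :> R by []; rewrite expr2; nra.
Qed.

(** With [j] a third of [k], Bernoulli's inequality bounds the power below by the cube of [j * c].
    The factor 25 in [D] comes from [k <= 5 * j]. *)
Lemma exp_beats_square (R : archiRealFieldType) (C c : R) :
  0 < c -> exists k0 : nat, forall k : nat, (k0 <= k)%N -> C * k%:R ^+ 2 < (1 + c) ^+ k.
Proof.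
move=> c0; pose D := `|C| * 25 / c ^+ 3.
have c3 : 0 < c ^+ 3 by rewrite exprn_gt0.
have D0 : 0 <= D by rewrite divr_ge0 ?mulr_ge0 // ltW.
exists (3 * (Num.bound D).+1)%N => k lek; set j := (k %/ 3)%N.
have ltDj : D < j%:R.
  apply: lt_le_trans (_ : (Num.bound D)%:R <= _); last by rewrite ler_nat; lia.
  exact: archi_boundP.
have j0 : 0 < j%:R :> R by apply: le_lt_trans ltDj.
have c1 : 1 <= 1 + c by lra.
apply: lt_le_trans (ler_weXn2l c1 (leq_trunc_div k 3)).
rewrite exprM; apply: lt_le_trans (_ : (j%:R * c) ^+ 3 <= _); last first.
  rewrite ler_pXn2r ?nnegrE ?mulr_ge0 ?exprn_ge0 //; try lra; try by rewrite ltW.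
  by apply: le_trans (bernoulli _ _); lra.
have kj : k%:R <= 5%:R * j%:R :> R by rewrite -natrM ler_nat; lia.
apply: le_lt_trans (_ : `|C| * (5 * j%:R) ^+ 2 < _).
  apply: le_trans (_ : `|C| * k%:R ^+ 2 <= _).
    by rewrite ler_wpM2r ?sqr_ge0 ?ler_norm.
  by rewrite ler_wpM2l // ler_sqr ?nnegrE // mulr_ge0.
rewrite !exprMn [(j%:R ^+ 3)]exprS.
rewrite (_ : `|C| * _ = (D * c ^+ 3) * j%:R ^+ 2); last first.
  by rewrite /D; field; rewrite gt_eqF.
have -> : j%:R * j%:R ^+ 2 * c ^+ 3 = (j%:R * c ^+ 3) * j%:R ^+ 2 by ring.
by rewrite ltr_pM2r ?exprn_gt0 // ltr_pM2r ?exprn_gt0.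
Qed.

(** The surplus yields [(1 + d) ^+ (2 * q)]. The rest, [(1 - d ^+ 2) ^+ b], is at least
    [(1 - d) ^+ q] by Bernoulli's inequality and [4 * N * d = 1]. Finally
    [(1 + d) ^+ 2 * (1 - d) >= 1 + d / 2], as [d <= 1 / 4]. *)
Lemma unbalanced_product (R : realFieldType) (d : R) (N q a b : nat) :
  (0 < N)%N -> d = (4 * N%:R)^-1 -> (b <= 4 * N * q)%N -> (b + 2 * q < a)%N ->
  (1 + d / 2) ^+ q <= (1 + d) ^+ a * (1 - d) ^+ b.
Proof.
move=> N0 dE bq ba; have N1 : 1 <= N%:R :> R by rewrite ler1n.
have d0 : 0 < d by rewrite dE invr_gt0 mulr_gt0 // ltr0n.
have dN : 4 * N%:R * d = 1 by rewrite dE mulfV // mulf_neq0 // pnatr_eq0 -lt0n.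
have d4 : d <= 1 / 4 by nra.
move: dE => _.
have dd : d * d <= d * (1 / 4) by rewrite ler_wpM2l // ltW.
have ddd : d * (d * d) <= d * (d * (1 / 4)) by rewrite ler_wpM2l // ltW.
have dd0 : 0 <= d * d by rewrite mulr_ge0 // ltW.
have m0 : 0 <= 1 - d by lra.
have p0 : 0 <= 1 + d by lra.
have pm0 : 0 <= (1 + d) * (1 - d) by rewrite mulr_ge0.
have pm1 : (1 + d) * (1 - d) <= 1 by lra.
have d2 : 0 <= 1 + d / 2 by lra.
apply: le_trans (_ : (1 + d) ^+ (b + 2 * q) * (1 - d) ^+ b <= _); last first.
  by rewrite ler_wpM2r ?exprn_ge0 ?ler_weXn2l ?lerDl ?(ltW d0) // ltnW.
rewrite exprD mulrAC -exprMn exprM.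
apply: le_trans (_ : (1 - d) ^+ q * ((1 + d) ^+ 2) ^+ q <= _).
  by rewrite -exprMn lerXn2r ?nnegrE ?mulr_ge0 ?sqr_ge0 // expr2; lra.
rewrite ler_wpM2r ?exprn_ge0 //.
apply: le_trans (_ : ((1 + d) * (1 - d)) ^+ (4 * N * q) <= _); last first.
  exact: ler_wiXn2l.
rewrite exprM lerXn2r ?nnegrE ?exprn_ge0 //.
rewrite (_ : (1 + d) * (1 - d) = 1 + - (d * d)); last by ring.
apply: le_trans (bernoulli _ _); last by lra.
by rewrite natrM mulrN mulrA dN mul1r.
Qed.

End Growth.

(** * Greedy choice of a reserved matching *)

Section Reserve.
Variables (T : finType) (S : {set T}) (e : rel T).

Lemma flat_cons m M : flat (m :: M) = [:: m.1, m.2 & flat M] :> seq T.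
Proof. by []. Qed.

Lemma size_flat (M : seq (T * T)) : size (flat M) = 2 * size M.
Proof. by elim: M => // m M IH; rewrite flat_cons /= IH; lia. Qed.

Variables (g j : nat).
Hypothesis g_gt0 : 0 < g.
Hypothesis many_links : forall (U : {set T}) s t, #|U| <= 2 * j ->
  s \in S -> t \notin S ->
  g <= #|[set m | [&& source_sink_edge S e m, links e s t m,
                      m.1 \notin U & m.2 \notin U]]|.

Local Open Scope ring_scope.

Let N2 : nat := (#|T| * #|T|)%N.
Let P : {set T * T} := [set p | (p.1 \in S) && (p.2 \notin S)].
(** A pair with fewer than [K] links weighs more than [2^-1 ^+ K], so a small total weight takes
    care of all pairs at once. *)
Let wt (M : seq (T * T)) (p : T * T) : rat := 2^-1 ^+ count (links e p.1 p.2) M.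
Let W (M : seq (T * T)) : rat := \sum_(p in P) wt M p.

Let wt_ge0 M p : 0 <= wt M p.
Proof. by rewrite exprn_ge0. Qed.

Let N2_bound (A : {set T * T}) : (#|A| <= N2)%N.
Proof. by rewrite /N2 -card_prod max_card. Qed.

(* One greedy step: by averaging, some edge avoiding M carries a proportion
   g / N2 of the total weight, and adding it to M halves that part. *)
Lemma add_link (M : seq (T * T)) : P != set0 -> (size M <= j)%N ->
  exists m, [/\ source_sink_edge S e m, m.1 \notin flat M, m.2 \notin flat M
    & N2%:R * W (m :: M) <= (N2%:R - g%:R / 2) * W M].
Proof.
move=> /set0Pn[p0 p0P] szM; pose U := [set x in flat M].
have cU : (#|U| <= 2 * j)%N.
  by rewrite cardsE (leq_trans (card_size _)) // size_flat leq_mul2l.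
pose A := [set m | [&& source_sink_edge S e m, m.1 \notin U & m.2 \notin U]].
pose load m := \sum_(p in P) wt M p *+ links e p.1 p.2 m.
have load_ge0 m : 0 <= load m by apply: sumr_ge0 => p _; rewrite mulrn_wge0.
have cardA p : p \in P -> (g <= \sum_(m in A) links e p.1 p.2 m)%N.
  rewrite inE => /andP[p1 p2]; apply: leq_trans (many_links cU p1 p2) _.
  rewrite -sum1_card big_mkcond [leqRHS]big_mkcond leq_sum // => m _.
  by rewrite !inE andbCA; case: (links _ _ _ m); rewrite /= ?andbF //; case: ifP.
have loadE : g%:R * W M <= \sum_(m in A) load m.
  rewrite exchange_big mulr_sumr; apply: ler_sum => p pP /=.
  by rewrite sumrMnr mulr_natl ler_wpMn2l // cardA.
have [m0 m0A] : exists m0, m0 \in A.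
  apply/set0Pn/eqP => A0; have := cardA _ p0P; rewrite A0 big_set0.
  by rewrite leqNgt g_gt0.
have [m mA hm] : exists2 m, m \in A & g%:R * W M <= N2%:R * load m.
  case: (@arg_maxP _ _ _ m0 (mem A) load m0A) => m mA mmax; exists m => //.
  apply: le_trans loadE _; apply: le_trans (_ : \sum_(i in A) load m <= _).
    exact: ler_sum.
  by rewrite sumr_const mulr_natl ler_wpMn2l // N2_bound.
exists m; move: mA; rewrite !inE => /and3P[em m1 m2]; split=> //.
suff -> : W (m :: M) = W M - load m / 2.
  by rewrite mulrBr mulrBl mulrA [_ / 2 * _]mulrAC lerD2l lerN2 ler_wpM2r.
rewrite /W /load mulr_suml -sumrB; apply: eq_bigr => p _; rewrite /wt /=.
by case: (links _ _ _ m); rewrite ?mulr0n ?mulr1n ?mul0r ?subr0 // exprS; lra.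
Qed.

Lemma reserve_links (K : nat) : P != set0 ->
  N2%:R * (1 - g%:R / (2 * N2%:R)) ^+ j < 2^-1 ^+ K :> rat ->
  exists M : seq (T * T), [/\ size M = j, uniq (flat M), all (source_sink_edge S e) M
    & forall s t, s \in S -> t \notin S -> (K <= count (links e s t) M)%N].
Proof.
move=> P0; set c := (1 - _) => small.
have N2_gt0 : 0 < N2%:R :> rat.
  by case/set0Pn: P0 => p _; rewrite ltr0n muln_gt0 andbb; apply/card_gt0P; exists p.1.
have gN2 : (g <= N2)%N.
  case/set0Pn: P0 => p; rewrite inE => /andP[p1 p2].
  by apply: leq_trans (many_links (U := set0) _ p1 p2) (N2_bound _); rewrite cards0.
have c0 : 0 <= c.
  rewrite subr_ge0 ler_pdivrMr ?mulr_gt0 // mul1r -natrM ler_nat.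
  by rewrite (leq_trans gN2) // leq_pmull.
have NcE : N2%:R - g%:R / 2 = N2%:R * c.
  by rewrite /c; field; rewrite gt_eqF.
have step i : (i <= j)%N -> exists M, [/\ size M = i, uniq (flat M),
    all (source_sink_edge S e) M & W M <= N2%:R * c ^+ i].
  elim: i => [_|i IH lij].
    exists [::]; split=> //; rewrite expr0 mulr1 /W /wt sumr_const ler_nat.
    exact: N2_bound.
  have [M [sM uM aM WM]] := IH (ltnW lij).
  have [|m [em m1 m2 hm]] := add_link (M := M) P0; first by rewrite sM ltnW.
  exists (m :: M); rewrite flat_cons /= sM em aM uM inE negb_or m1 m2; split=> //.
    have /and3P[m1S m2S _] := em; rewrite !andbT.
    by apply: contraNneq m2S => <-.
  rewrite -(ler_pM2l N2_gt0); apply: le_trans hm _.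
  by rewrite NcE -mulrA ler_pM2l // exprS mulrCA ler_wpM2l.
have [M [sM uM aM WM]] := step j (leqnn _).
exists M; split=> // s t sS tS; rewrite leqNgt; apply/negP => lt.
have stP : (s, t) \in P by rewrite inE /= sS.
have : W M < 2^-1 ^+ K by apply: le_lt_trans small.
rewrite /W (bigD1 _ stP) /= ltNge => /negP; apply.
rewrite -[leLHS]addr0 lerD ?sumr_ge0 // /wt /=.
by rewrite ler_wiXn2l // ltnW.
Qed.

End Reserve.

(** * Assembling the bipartite Hamiltonian cycle *)

(** The last clause strengthens the induction: a list that can follow any sink and then ends in a
    sink can be preceded by a new source-sink pair. *)
Lemma alternating_list (T : finType) (S : {set T}) k (A B : {set T}) :
  A \subset S -> B \subset ~: S -> #|A| = k -> #|B| = k ->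
  exists L, [/\ uniq L, L =i A :|: B, cycle (across S) L &
    forall y, y \notin S -> path (across S) y L && (last y L \notin S)].
Proof.
elim: k A B => [|k IH] A B AS BS cA cB.
  exists [::]; split=> //; move: (cards0_eq cA) (cards0_eq cB) => -> -> x.
  by rewrite setU0 !inE.
have [a aA] : exists a, a \in A by apply/card_gt0P; rewrite cA.
have [b bB] : exists b, b \in B by apply/card_gt0P; rewrite cB.
have aS := subsetP AS _ aA; have := subsetP BS _ bB; rewrite inE => bS.
have [||||L [uL mL cL pL]] := IH (A :\ a) (B :\ b).
- exact: subset_trans (subD1set _ _) AS.
- exact: subset_trans (subD1set _ _) BS.
- by move: cA; rewrite (cardsD1 a) aA => -[].
- by move: cB; rewrite (cardsD1 b) bB => -[].
have aB : a \notin B by apply: contraTN aS => /(subsetP BS); rewrite inE.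
have bA : b \notin A by apply: contra bS; apply: (subsetP AS).
have ab : a != b by apply: contraNneq bS => <-.
have path_ab y : y \notin S ->
    path (across S) y [:: a, b & L] && (last y [:: a, b & L] \notin S).
  by move=> yS; rewrite /= {1 2}/across aS (negPf yS) (negPf bS) /= pL.
exists [:: a, b & L]; split.
- rewrite /= uL inE negb_or ab !mL !inE !eqxx /= (negPf aB) (negPf bA).
  by rewrite !andbF.
- move=> x; rewrite !inE mL !inE.
  have [->|_] := eqVneq x a; first by rewrite aA.
  by have [->|_] := eqVneq x b; rewrite ?bB ?orbT.
- have /andP[/= /and3P[_ eab pLb] lS] := path_ab b bS.
  by rewrite /= rcons_path eab pLb /= /across aS; move: lS; case: (_ \in S).
- exact: path_ab.
Qed.

Lemma card_flat_source (T : finType) (S : {set T}) (e : rel T) (M : seq (T * T)) :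
  uniq (flat M) -> all (source_sink_edge S e) M ->
  #|[set x in flat M] :&: S| = size M /\ #|[set x in flat M] :&: ~: S| = size M.
Proof.
move=> uM aM.
have cnt (B : {set T}) : #|[set x in flat M] :&: B| = count (mem B) (flat M).
  rewrite -size_filter -(card_uniqP (filter_uniq _ uM)); apply: eq_card => x.
  by rewrite !inE mem_filter andbC.
rewrite !cnt; elim: M {uM cnt} aM => // m M IH /= /andP[/and3P[m1 m2 _] /IH[-> ->]].
by rewrite !inE m1 (negPf m2).
Qed.

(** Here [l] bounds the cut segments, [j] counts the reserved edges and [K] bounds the breaks left
    to close. The slack [l + 2 * j] in the degrees covers the loss of the reserved vertices and of
    one segment. *)
Lemma bipartite_hamiltonian (T : finType) (S : {set T}) (e : rel T)
    (kappa g l j K : nat) :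
  symmetric e -> subrel e (across S) -> #|S| = #|~: S| -> 0 < #|S| ->
  (forall x, kappa + l + 2 * j <= #|nbhd e x|) ->
  (forall X Y : {set T}, X \subset S -> Y \subset ~: S ->
    kappa <= #|X| -> kappa <= #|Y| ->
    g <= #|[set z | [&& z.1 \in X, z.2 \in Y & e z.1 z.2]]|) ->
  0 < g -> 0 < l -> 2 * (#|T| %/ l).+1 + 1 <= K ->
  ((#|T| * #|T|)%:R * (1 - g%:R / (2 * (#|T| * #|T|)%:R)) ^+ j < 2^-1 ^+ K :> rat)%R ->
  exists L : seq T, [/\ uniq L, forall x, x \in L & cycle e L].
Proof.
move=> e_sym e_ac cS S0 deg dense g0 l0 leK small.
have degU (U : {set T}) x : #|U| <= 2 * j -> kappa + l <= #|nbhd e x :\: U|.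
  move=> cU; rewrite -(leq_add2r (2 * j)); apply: leq_trans (deg x) _.
  rewrite -(cardsID U (nbhd e x)) addnC leq_add2l (leq_trans _ cU) //.
  by rewrite subset_leq_card // subsetIr.
have e_dense (X Y : {set T}) : X \subset S -> Y \subset ~: S ->
    kappa <= #|X| -> kappa <= #|Y| -> exists x y, [/\ x \in X, y \in Y & e x y].
  move=> XS YS kX kY; have := leq_trans g0 (dense X Y XS YS kX kY).
  by case/card_gt0P => -[x y]; rewrite inE => /and3P[*]; exists x, y.
(* A link of [s] and [t] off [U] is an edge between their remaining neighbourhoods, so density
   counts links. *)
have links_many (U : {set T}) s t : #|U| <= 2 * j -> s \in S -> t \notin S ->
    g <= #|[set m | [&& source_sink_edge S e m, links e s t m,
                      m.1 \notin U & m.2 \notin U]]|.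
  move=> cU sS tS.
  have XS : nbhd e t :\: U \subset S.
    apply/subsetP=> x; rewrite !inE => /andP[_ /e_ac].
    by rewrite /across (negPf tS); case: (x \in S).
  have YS : nbhd e s :\: U \subset ~: S.
    apply/subsetP=> x; rewrite !inE => /andP[_ /e_ac].
    by rewrite /across sS; case: (x \in S).
  have k x : kappa <= #|nbhd e x :\: U|.
    by apply: leq_trans (degU U x cU); rewrite leq_addr.
  apply: leq_trans (dense _ _ XS YS (k t) (k s)) _.
  apply/subset_leq_card/subsetP => -[x y]; rewrite !inE /= => /and3P[hx hy exy].
  have := subsetP XS x; have := subsetP YS y; rewrite !inE hx hy => /(_ isT) yS /(_ isT) xS.
  move/andP: hx => [-> tx]; move/andP: hy => [-> sy].
  by rewrite /source_sink_edge /links xS yS exy tx sy.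
have P0 : [set p : T * T | (p.1 \in S) && (p.2 \notin S)] != set0.
  have /card_gt0P[s sS] := S0; move: S0; rewrite cS => /card_gt0P[t tS].
  by apply/set0Pn; exists (s, t); rewrite !inE in tS *; rewrite sS.
have [M [sM uM aM cM]] := reserve_links g0 links_many P0 small.
pose U := [set x in flat M].
have cU : #|U| <= 2 * j by rewrite cardsE (leq_trans (card_size _)) // size_flat sM.
have [cUS cUC] := card_flat_source uM aM.
(* The reserved edges use equally many vertices of each side, so the remaining ones can be listed
   alternately. *)
have [||||L0 [uL0 mL0 cL0 _]] := @alternating_list T S #|S :\: U| (S :\: U) (~: S :\: U).
- by rewrite subsetDl.
- by rewrite subsetDl.
- by [].
- by apply/eqP; rewrite -(eqn_add2l (size M)) -{1}cUC -cUS !(setIC U) !cardsID cS.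
have setL0 : [set y in L0] = ~: U.
  by apply/setP=> y; rewrite in_set mL0 !inE; case: (y \in S); rewrite ?andbT ?andbF ?orbF.
have deg0 x : kappa + l <= #|nbhd e x :&: [set y in L0]|.
  by rewrite setL0 -setDE degU.
have [L1 [p1 c1 b1]] := few_breaks e_sym e_ac e_dense uL0 cL0 l0 deg0.
have [|L2 [M2 [p2 c2 sM2 sL2]]] := connect_breaks e_sym e_ac c1 aM.
  move=> s t sS tS; apply: leq_trans (cM s t sS tS); apply: leq_trans leK.
  apply: leq_trans b1 _; rewrite leq_add2r leq_mul2l /= ltnS leq_div2r //.
  by rewrite -(card_uniqP uL0) max_card.
have uLM : uniq (L2 ++ flat M2).
  rewrite (perm_uniq p2) cat_uniq (perm_uniq p1) uL0 uM andbT.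
  apply/hasPn => x xM; rewrite /= (perm_mem p1) mL0 !inE.
  by rewrite xM.
have [||L3 [p3 c3]] := absorb_edges e_sym e_ac e_dense uLM c2.
- by apply/allP=> m /sM2/(allP aM).
- move=> x; apply: leq_trans (leq_addr l _) (leq_trans (deg0 x) _).
  apply/subset_leq_card/setIS/subsetP => y; rewrite !inE -(perm_mem p1).
  exact: sL2.
exists L3; split=> //; first by rewrite (perm_uniq p3).
move=> x; rewrite (perm_mem p3) (perm_mem p2) mem_cat (perm_mem p1) mL0 !inE.
by case: (x \in flat M); case: (x \in S).
Qed.

(** * Even splits of the vertex set *)

Section Discrepancy.
Variables (T : finType) (Fs : seq {set T}) (N q : nat).
Local Open Scope ring_scope.

Let d : rat := (4 * N%:R)^-1.
(** Over a uniformly random [f] the factors are independent with mean 1; a surplus of [F] on side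
    [s] makes the product exponentially large. *)
Let pot (F : {set T}) (f : {ffun T -> bool}) (s : bool) : rat :=
  \prod_x (if x \in F then if f x == s then 1 + d else 1 - d else 1).
Let side (f : {ffun T -> bool}) (s : bool) : {set T} := [set x | f x == s].

Lemma potE F f s :
  pot F f s = (1 + d) ^+ #|F :&: side f s| * (1 - d) ^+ #|F :&: side f (~~ s)|.
Proof.
rewrite -!prodr_const [X in X * _]big_mkcond [X in _ * X]big_mkcond -big_split.
apply: eq_bigr => x _; rewrite !inE; case: (x \in F) => /=; rewrite ?mulr1 //.
by case: (f x); case: s; rewrite /= ?mulr1 ?mul1r.
Qed.

Lemma sum_pot F s : \sum_f pot F f s = 2 ^+ #|T|.
Proof.
rewrite -(bigA_distr_bigA (fun x b => if x \in F then if b == s then 1 + d else 1 - d else 1)) /=.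
rewrite -[RHS]prodr_const; apply: eq_bigr => x _.
by rewrite big_bool; case: (x \in F); case: s => /=; ring.
Qed.

Hypotheses (N_gt0 : (0 < N)%N) (T_le : (#|T| <= 4 * N * q)%N).

(** The potentials, summed over the family and both sides, average to [2 * size Fs], so some split
    does no worse. A set with surplus above [2 * q] would alone contribute [(1 + d / 2) ^+ q]. *)
Lemma low_discrepancy : 2 * (size Fs)%:R < (1 + d / 2) ^+ q ->
  exists S : {set T}, forall F, F \in Fs ->
    (#|F :&: S| <= #|F :&: ~: S| + 2 * q)%N /\ (#|F :&: ~: S| <= #|F :&: S| + 2 * q)%N.
Proof.
move=> few; pose Phi f := \sum_(F <- Fs) (pot F f true + pot F f false).
have d4 : d <= 1 / 4.
  by rewrite /d div1r lef_pV2 ?posrE ?mulr_gt0 ?ltr0n // ler_peMr // ler1n.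
have d0 : 0 < d by rewrite invr_gt0 mulr_gt0 // ltr0n.
have m0 : 0 <= 1 - d by lra.
have p0 : 0 <= 1 + d by lra.
have pot0 F f s : 0 <= pot F f s by rewrite potE mulr_ge0 // exprn_ge0.
have sumPhi : \sum_f Phi f = 2 ^+ #|T| * (2 * (size Fs)%:R).
  rewrite exchange_big /= -[size Fs]count_predT -sum1_count natr_sum !mulr_sumr.
  by apply: eq_bigr => F _; rewrite big_split /= !sum_pot; ring.
have [f hf] : exists f, Phi f <= 2 * (size Fs)%:R.
  have f0 : {ffun T -> bool} := [ffun=> true].
  case: (@arg_minP _ _ _ f0 xpredT Phi isT) => f _ fmin; exists f.
  have p2 : 0 < 2 ^+ #|T| :> rat by rewrite exprn_gt0.
  rewrite -(ler_pM2l p2) -sumPhi.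
  apply: le_trans (_ : \sum_(g : {ffun T -> bool}) Phi f <= _); last first.
    by apply: ler_sum => g _; apply: fmin.
  by rewrite sumr_const cardT -cardE card_ffun card_bool -[leRHS]mulr_natl natrX.
have bound F s : F \in Fs -> (#|F :&: side f s| <= #|F :&: side f (~~ s)| + 2 * q)%N.
  move=> FF; rewrite leqNgt; apply/negP => lt.
  have := le_lt_trans hf few; rewrite ltNge => /negP; apply.
  apply: le_trans (unbalanced_product N_gt0 (erefl d) (leq_trans (max_card _) T_le) lt) _.
  rewrite -potE.
  rewrite /Phi (big_rem _ FF) /= -[leLHS]addr0 lerD //; last first.
    by apply: sumr_ge0 => G _; rewrite addr_ge0.
  by case: s {lt}; rewrite ?lerDl ?lerDr.
exists (side f true) => F FF; have -> : ~: side f true = side f false.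
  by apply/setP=> x; rewrite !inE; case: (f x).
by split; [apply: (bound F true) | apply: (bound F false)].
Qed.

End Discrepancy.

Lemma subset_of_card (T : finType) (A : {set T}) k :
  k <= #|A| -> exists2 B : {set T}, B \subset A & #|B| = k.
Proof.
move=> kA; exists [set x in take k (enum A)].
  by apply/subsetP=> x; rewrite inE => /mem_take; rewrite mem_enum.
by rewrite cardsE (card_uniqP (take_uniq _ (enum_uniq _))) size_takel // -cardE.
Qed.

(** Adding [setT] to the family makes the larger side exceed [n] by at most [q], and moving this
    surplus makes the split exact. The error [4 * q] is [2 * q] from the discrepancy plus twice the
    number of moved vertices. *)
Lemma balanced_split (T : finType) (Fs : seq {set T}) (N n q : nat) :
  0 < N -> #|T| = 2 * n -> n <= 2 * N * q ->
  (2 * (size Fs).+1%:R < (1 + (4 * N%:R)^-1 / 2) ^+ q :> rat)%R ->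
  exists S : {set T}, #|S| = n /\ forall F, F \in Fs ->
    #|F| <= 2 * #|F :&: S| + 4 * q /\ #|F| <= 2 * #|F :&: ~: S| + 4 * q.
Proof.
move=> N0 cT nN few.
have [|S0 hS0] := @low_discrepancy T (setT :: Fs) N q N0 _ few; first by rewrite cT; lia.
have [c1 c2] := hS0 setT (mem_head _ _).
rewrite !setTI in c1 c2; have cC := cardsC S0; rewrite cT in cC.
wlog nS : S0 hS0 c1 c2 cC / n <= #|S0|.
  move=> W; have [|lt] := leqP n #|S0|; first exact: W.
  by apply: (W (~: S0)); rewrite ?setCK //; [move=> F /hS0[] | lia | lia].
have [S SS0 cS] := subset_of_card nS.
have cD : #|S0 :\: S| <= q.
  by have := cardsID S S0; rewrite (setIidPr SS0) cS; lia.
exists S; split=> // F FF; have [h1 h2] := hS0 F (mem_behead (s := setT :: Fs) FF).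
have e0 := cardsID S0 F; have e1 := cardsID S F; rewrite !setDE in e0 e1.
have le1 : #|F :&: S0| <= #|F :&: S| + q.
  rewrite -(cardsID S (F :&: S0)); apply: leq_add.
    by rewrite subset_leq_card // setSI // subsetIl.
  by apply: leq_trans cD; rewrite subset_leq_card // setSD // subsetIr.
have le2 : #|F :&: ~: S0| <= #|F :&: ~: S|.
  by rewrite subset_leq_card // setIS // setCS.
by split; lia.
Qed.

(** * Density of the split of a non-extremal digraph *)

Lemma card_edges (T : finType) (r : rel T) (X Y : {set T}) :
  #|[set z | [&& z.1 \in X, z.2 \in Y & r z.1 z.2]]| =
  \sum_(x in X) #|out_nbhd r x :&: Y|.
Proof.
rewrite -sum1_card (eq_bigl (fun z : T * T => (z.1 \in X) && ((z.2 \in Y) && r z.1 z.2)));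
  last by move=> z; rewrite inE.
rewrite -(pair_big_dep (mem X) (fun x y => (y \in Y) && r x y) (fun _ _ => 1)) /=.
apply: eq_bigr => x _; rewrite -sum1_card; apply: eq_bigl => y.
by rewrite !inE andbC.
Qed.

Lemma exchange_degrees (T : finType) (r : rel T) (X Y : {set T}) :
  \sum_(x in X) #|out_nbhd r x :&: Y| = \sum_(y in Y) #|in_nbhd r y :&: X|.
Proof.
have E (A B : {set T}) : #|A :&: B| = \sum_(y in B) (y \in A).
  rewrite -sum1_card big_mkcond [RHS]big_mkcond; apply: eq_bigr => y _.
  by rewrite inE; case: (y \in A); case: (y \in B).
under eq_bigr do rewrite E; under [RHS]eq_bigr do rewrite E.
by rewrite exchange_big; apply: eq_bigr => y _; apply: eq_bigr => x _; rewrite !inE.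
Qed.

Lemma markov_card (T : finType) (X : {set T}) (f : T -> nat) c :
  c * #|[set x in X | c <= f x]| <= \sum_(x in X) f x.
Proof.
rewrite mulnC -sum_nat_const [leqRHS](bigID (fun x => c <= f x)) /=.
apply: leq_trans (leq_addr _ _); rewrite (eq_bigl (fun x => (x \in X) && (c <= f x))).
  by apply: leq_sum => x /andP[].
by move=> x; rewrite inE.
Qed.

Section DenseSplit.
Variables (T : finType) (E : rel T) (S : {set T}) (n q a : nat).

Definition halved (F : {set T}) :=
  #|F| <= 2 * #|F :&: S| + 4 * q /\ #|F| <= 2 * #|F :&: ~: S| + 4 * q.

(** The difference is one-sided: it counts the edges from [z] into the complement of the
    out-neighbourhood of [x], which must be few in an extremal pair. *)
Definition twins (x : T) : {set T} :=
  [set z | #|out_nbhd E z :\: out_nbhd E x| <= 24 * q].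

Hypotheses (cardT : #|T| = 2 * n) (cardS : #|S| = n).
Hypotheses (q_gt0 : 0 < q) (q_n : 12 * q < n) (q_a : 32 * q <= a).
Hypothesis nq_aa : 48 * (n * q) <= a * a.
Hypothesis outdeg : forall x, n <= #|out_nbhd E x| + 2 * q.
Hypothesis halved_out : forall x, halved (out_nbhd E x).
Hypothesis halved_diff : forall x z, halved (out_nbhd E z :\: out_nbhd E x).
Hypothesis halved_twins : forall x, halved (twins x).
Hypothesis not_extremal : forall A B : {set T},
  n <= #|A| + a -> #|A| <= n -> n <= #|B| + a -> #|B| <= n ->
  (forall x, x \in A -> #|out_nbhd E x :&: B| <= a) ->
  (forall y, y \in B -> #|in_nbhd E y :&: A| <= a) -> False.

(* The few edges from X to Y force most x in X to have out-neighbourhood close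
   to the complement of Y in ~: S, so most of X are twins of each other, first
   inside ~: S and then, by halving, everywhere; twins of x versus the
   complement of the out-neighbourhood of x is an extremal pair. *)
Lemma dense_split (X Y : {set T}) :
  X \subset S -> Y \subset ~: S -> n <= 2 * #|X| + 10 * q -> n <= 2 * #|Y| + 10 * q ->
  q * q <= #|[set z | [&& z.1 \in X, z.2 \in Y & E z.1 z.2]]|.
Proof.
move=> XS YS kX kY; rewrite card_edges leqNgt; apply/negP => few.
have cardC : #|~: S| = n by have := cardsC S; rewrite cardT cardS; lia.
pose X1 := [set x in X | q <= #|out_nbhd E x :&: Y|].
have cX1 : #|X1| < q.
  rewrite -(ltn_pmul2l q_gt0).
  by apply: leq_ltn_trans (markov_card X (fun x => #|out_nbhd E x :&: Y|) q) few.
have X0P z : z \in X :\: X1 -> #|out_nbhd E z :&: Y| < q.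
  by rewrite !inE => /andP[+ zX]; rewrite zX -ltnNge.
have cX0 : #|X| <= #|X :\: X1| + q.
  rewrite -(cardsID X1 X) addnC leq_add2l ltnW //.
  by apply: leq_ltn_trans cX1; rewrite subset_leq_card // subsetIr.
have [x xX0] : exists x, x \in X :\: X1.
  by apply/card_gt0P; move: cX0 kX q_n; clear; lia.
pose O z := out_nbhd E z :&: ~: S.
have splitO z : #|O z| = #|out_nbhd E z :&: Y| + #|O z :\: Y|.
  by rewrite -(cardsID Y (O z)) /O -setIA (setIidPr YS).
have cCY : #|~: S :\: Y| + #|Y| = n.
  by rewrite -cardC -(cardsID Y (~: S)) (setIidPr YS) addnC.
have OY z : O z :\: Y \subset ~: S :\: Y by rewrite setSD // subsetIr.
(* In [~: S], an out-neighbour of [z] but not of [x] is one of fewer than [q] in [Y] or lies outside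
   [Y], where at most [n / 2 + 5 * q] vertices exist and [x] reaches at least [n / 2 - 4 * q]. That
   makes at most [10 * q]; halving doubles this and adds [4 * q]. *)
have twin z : z \in X :\: X1 -> z \in twins x.
  move=> zX0; rewrite inE.
  have [_ h] := halved_diff x z; have := X0P _ zX0; have := X0P _ xX0.
  have [_ hx] := halved_out x; have dx := outdeg x.
  have sx := splitO x.
  have sub : (out_nbhd E z :\: out_nbhd E x) :&: ~: S \subset
      (out_nbhd E z :&: Y) :|: ((~: S :\: Y) :\: (O x :\: Y)).
    apply/subsetP=> y; rewrite !inE.
    by case: (E z y); case: (E x y); case: (y \in Y); case: (y \in S).
  have := subset_leq_card sub; rewrite cardsU cardsD (setIidPr (OY x)).
  have := subset_leq_card (OY x).
  move: h hx dx sx cCY kY; rewrite -/(O x); clear; lia.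
have [_ hA] := halved_twins x.
(* At least [n / 2 - 6 * q] twins lie in [S], and halving of [twins x] doubles this up to
   [4 * q]. *)
have cA : n <= #|twins x| + 16 * q.
  have hS : #|twins x :&: S| >= #|X :\: X1|.
    apply/subset_leq_card/subsetP=> z zX0; rewrite inE twin //.
    by apply: (subsetP XS); move: zX0; rewrite inE => /andP[].
  have := cardsID S (twins x); rewrite setDE.
  by move: hA hS cX0 kX; clear; lia.
have cO : #|out_nbhd E x| <= n + 16 * q.
  have [_ h] := halved_out x; have := X0P _ xX0; have := splitO x.
  have := subset_leq_card (OY x).
  by move: h cCY kY; rewrite -/(O x); clear; lia.
have [A AA cA'] := subset_of_card (geq_minl #|twins x| n).
pose C := ~: out_nbhd E x.
have cC : #|C| + #|out_nbhd E x| = 2 * n by rewrite -cardT -(cardsC (out_nbhd E x)) addnC.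
have outA z : z \in A -> #|out_nbhd E z :&: C| <= 24 * q.
  by move/(subsetP AA); rewrite inE setDE.
(* Vertices with too many in-neighbours in [A] are discarded. Double counting the at most
   [n * (24 * q)] edges from [A] to [C], with [48 * (n * q) <= a * a], shows that they number at
   most [a / 2]. *)
pose C1 := [set y in C | a < #|in_nbhd E y :&: A|].
have cC1 : a.+1 * #|C1| <= n * (24 * q).
  apply: leq_trans (markov_card C (fun y => #|in_nbhd E y :&: A|) a.+1) _.
  rewrite -exchange_degrees; apply: leq_trans (_ : \sum_(z in A) 24 * q <= _).
    exact: leq_sum.
  by rewrite sum_nat_const leq_mul2r cA' geq_minr orbT.
have cC1' : 2 * #|C1| <= a.
  rewrite leqNgt; apply/negP => lt.
  have : (2 * (a.+1 * #|C1|)) <= a * a by move: cC1 nq_aa; clear; lia.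
  by move: lt; clear; nia.
have cCD : #|C| <= #|C :\: C1| + #|C1|.
  by rewrite -(cardsID C1 C) addnC leq_add2l subset_leq_card // subsetIr.
have [B BC cB] := subset_of_card (geq_minl #|C :\: C1| n).
apply: (@not_extremal A B).
- by move: cA cA' q_a; rewrite minnE; clear; lia.
- by rewrite cA' geq_minr.
(* The losses [16 * q] and [a / 2] add up to at most [a]. *)
- by move: cB cCD cC1' cC cO q_a; rewrite minnE; clear; lia.
- by rewrite cB geq_minr.
- move=> z zA; apply: leq_trans (_ : 24 * q <= a); last by move: q_a; clear; lia.
  apply: leq_trans (outA z zA); apply/subset_leq_card/setIS.
  exact: subset_trans BC (subsetDl _ _).
- by move=> y /(subsetP BC); rewrite !inE => /andP[+ yC]; rewrite yC /= -leqNgt.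
Qed.

End DenseSplit.

(** * Choice of the integer parameters *)

(** As [n <= 2 * N * q], the base is at most [1 - c <= (1 + c)^-1]; as [n] is at most linear in [j],
    exponential growth wins. The factor 1024 is [4 * (2 * 8) ^ 2]. *)
Lemma weight_bound (R : archiRealFieldType) (N K : nat) : 0 < N ->
  exists j0 : nat, forall j q n : nat,
    j0 <= j -> q <= 8 * j -> 0 < q <= n -> n <= 2 * N * q ->
    ((2 * n * (2 * n))%:R * (1 - (q * q)%:R / (2 * (2 * n * (2 * n))%:R)) ^+ j
      < 2^-1 ^+ K :> R)%R.
Proof.
move=> N0; pose c : R := ((32 * (N * N))%:R^-1)%R.
have c0 : (0 < c)%R by rewrite invr_gt0 ltr0n !muln_gt0 N0.
have [j0 hj0] := exp_beats_square ((1024 * (N * N) * 2 ^ K)%:R)%R c0.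
exists j0 => j q n lej qj /andP[q0 qn] nN.
have n0 : 0 < n by apply: leq_trans qn.
set M := (2 * n * (2 * n))%N; have M0 : (0 < 2 * M%:R :> R)%R.
  by rewrite mulr_gt0 // ltr0n !muln_gt0 n0.
have c'c : (c <= (q * q)%:R / (2 * M%:R))%R.
  rewrite ler_pdivlMr // /c mulrC ler_pdivrMr ?ltr0n ?muln_gt0 ?N0 //.
  rewrite -!natrM ler_nat /M.
  by have := leq_mul nN nN; clear; lia.
have c'1 : (0 <= 1 - (q * q)%:R / (2 * M%:R) :> R)%R.
  rewrite subr_ge0 ler_pdivrMr // mul1r -natrM ler_nat /M.
  by have := leq_mul qn qn; clear; lia.
have ub : ((1 - (q * q)%:R / (2 * M%:R)) ^+ j <= ((1 + c)^-1) ^+ j)%R.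
  have c1 : (0 < 1 + c)%R by lra.
  rewrite lerXn2r ?nnegrE ?invr_ge0 ?(ltW c1) //.
  apply: le_trans (_ : (1 - c <= _)%R); first by rewrite lerD2l lerN2.
  rewrite -[leRHS]mul1r ler_pdivlMr //.
  have := sqr_ge0 c; rewrite expr2; lra.
apply: le_lt_trans (ler_wpM2l (ler0n _ _) ub) _.
rewrite !exprVn ltr_pdivrMr ?exprn_gt0 //; last by lra.
rewrite mulrC ltr_pdivlMr ?exprn_gt0 // -natrX.
apply: le_lt_trans (hj0 j lej); rewrite -natrX -!natrM ler_nat /M.
have := leq_mul nN nN; have := leq_mul qj qj => h2 h1.
rewrite [leqRHS]mulnAC leq_mul2r -mulnn; apply/orP; right.
apply: leq_trans (_ : 4 * (2 * N * q * (2 * N * q)) <= _).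
  by move: h1; clear; lia.
by have := leq_mul (leqnn (N * N)) h2; clear; lia.
Qed.

Definition split_graph (T : finType) (S : {set T}) (E : rel T) : rel T :=
  fun x y => [&& x \in S, y \notin S & E x y] || [&& y \in S, x \notin S & E y x].

Lemma antidirected_hamiltonian (N : nat) : 0 < N ->
  exists q0 : nat, forall (q n a : nat) (T : finType) (E : rel T),
    q0 <= q -> n <= 2 * N * q -> 12 * q < n -> 32 * q <= a ->
    48 * (n * q) <= a * a -> #|T| = 2 * n ->
    (forall x, n <= #|out_nbhd E x| + 2 * q) ->
    (forall x, n <= #|in_nbhd E x| + 2 * q) ->
    (forall A B : {set T},
      n <= #|A| + a -> #|A| <= n -> n <= #|B| + a -> #|B| <= n ->
      (forall x, x \in A -> #|out_nbhd E x :&: B| <= a) ->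
      (forall y, y \in B -> #|in_nbhd E y :&: A| <= a) -> False) ->
    has_antidirected_hamiltonian_cycle E.
Proof.
move=> N0; pose d : rat := ((4 * N%:R)^-1 / 2)%R.
have d0 : (0 < d)%R by rewrite divr_gt0 // invr_gt0 mulr_gt0 // ltr0n.
have [k1 hk1] := exp_beats_square ((88 * (N * N))%:R)%R d0.
have [j0 hj0] := weight_bound rat (64 * N + 3) N0.
exists (k1 + 4 * j0 + 8) => q n a T E qbig nN q_n q_a nq_aa cT dout din next.
have q0 : 0 < q by apply: leq_trans qbig; rewrite addnS.
pose Fs := [seq out_nbhd E x | x : T] ++ [seq in_nbhd E x | x : T] ++
  [seq twins E q x | x : T] ++
  [seq out_nbhd E z.2 :\: out_nbhd E z.1 | z : T * T].
have [|S [cS hS]] := @balanced_split T Fs N n q N0 cT nN.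
  (* There are [6 * n + 4 * n ^ 2] sets; with [setT] added and doubled this is at most
     [22 * n ^ 2 <= 88 * N ^ 2 * q ^ 2]. *)
  apply: le_lt_trans (hk1 q _); last by move: qbig; clear; lia.
  rewrite -natrX -!natrM ler_nat !size_cat !size_image card_prod cT -mulnn.
  have := leq_mul nN nN; have n1 : 0 < n by apply: leq_ltn_trans q_n.
  have := leq_mul n1 (leqnn n); have := leq_mul n1 n1; clear; lia.
have [hout hin htw hdf] : [/\ forall x, halved S q (out_nbhd E x),
    forall x, halved S q (in_nbhd E x), forall x, halved S q (twins E q x)
  & forall x z, halved S q (out_nbhd E z :\: out_nbhd E x)].
  split=> [x|x|x|x z]; apply: (hS _ _); rewrite !mem_cat.
  - by rewrite image_f.
  - by rewrite (image_f (in_nbhd E)) ?orbT.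
  - by rewrite (image_f (twins E q)) ?orbT.
  - by rewrite (image_f (fun z => out_nbhd E z.2 :\: out_nbhd E z.1) (x := (x, z))) ?orbT.
pose e := split_graph S E.
have e_sym : symmetric e by move=> x y; rewrite /e /split_graph orbC.
have e_ac : subrel e (across S).
  move=> x y; rewrite /e /split_graph /across.
  by case: (x \in S); case: (y \in S).
have nb x : nbhd e x = if x \in S then out_nbhd E x :&: ~: S else in_nbhd E x :&: S.
  apply/setP=> y; rewrite inE /e /split_graph.
  by case: (boolP (x \in S)) => xS; rewrite !inE /=; case: (y \in S); rewrite ?andbF ?andbT ?orbF.
have cC : #|S| = #|~: S| by have := cardsC S; rewrite cT cS; clear; lia.
(* Degrees in [e] are at least [n / 2 - 3 * q], which leaves room for [kappa + 3 * l]; [l] serves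
   both as segment length and as number of reserved edges. *)
pose kappa := n.+1./2 - 5 * q; pose l := q %/ 4.
have kP k : kappa <= k -> n <= 2 * k + 10 * q.
  by rewrite /kappa; clear; lia.
have q8l : q <= 8 * l by move: qbig; rewrite /l; clear; lia.
have l0 : 0 < l by move: qbig; rewrite /l; clear; lia.
have [|||||||L [uL aL cL]] :=
  @bipartite_hamiltonian T S e kappa (q * q) l l (64 * N + 3) e_sym e_ac cC.
- by rewrite cS; apply: leq_ltn_trans q_n.
- move=> x; apply: (@leq_trans (kappa + q)).
    by rewrite /l; clear; lia.
  suff : n <= 2 * #|nbhd e x| + 6 * q.
    by rewrite /kappa; move: q_n q0; clear; lia.
  rewrite nb; case: ifP => _.
    by have [_] := hout x; move: (dout x); clear; lia.
  by have [+ _] := hin x; move: (din x); clear; lia.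
- move=> X Y XS YS kX kY.
  apply: leq_trans (@dense_split T E S n q a cT cS q0 q_n q_a nq_aa dout hout hdf htw
    next X Y XS YS (kP _ kX) (kP _ kY)) _.
  apply/subset_leq_card/subsetP => -[x y]; rewrite !inE /= => /and3P[xX yY xy].
  rewrite xX yY /e /split_graph (subsetP XS _ xX) xy.
  by have := subsetP YS _ yY; rewrite inE => ->.
- by rewrite muln_gt0 q0.
- by [].
(* From [2 * n <= 32 * N * l] the bound on breaks is [2 * (32 * N + 1) + 1]. *)
- rewrite cT -[64 * N + 3]/(64 * N + (2 + 1)) addnA leq_add2r.
  suff : 2 * n %/ l <= 32 * N by clear; lia.
  rewrite -(mulnK (32 * N) l0) leq_div2r //.
  by have := leq_mul (leqnn (4 * N)) q8l; move: nN; clear; lia.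
- rewrite cT; apply: hj0 => //.
  + by move: qbig; rewrite /l; clear; lia.
  + by rewrite q0; move: q_n; clear; lia.
apply: (@antidirected_of_cycle T S E e L) => //.
- by move=> x y xS; rewrite /e /split_graph xS /= andbF orbF => /andP[].
- have -> : size L = 2 * n.
    by rewrite -cT -(card_uniqP uL); apply: eq_card => x; rewrite aL.
  by move: q_n q0; clear; lia.
Qed.

(** * From real parameters to integer error terms *)

Lemma min_semideg_le (T : finType) (E : rel T) (x : T) :
  min_semideg E <= #|out_nbhd E x| /\ min_semideg E <= #|in_nbhd E x|.
Proof.
have le (f : T -> nat) : \big[minn/#|T|]_(y : T) f y <= f x.
  by rewrite -minEnat -leEnat; apply: bigmin_le.
split; first exact: leq_trans (geq_minl _ _) (le (fun y => #|out_nbhd E y|)).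
exact: leq_trans (geq_minr _ _) (le (fun y => #|in_nbhd E y|)).
Qed.

Local Open Scope ring_scope.

Theorem theorem3p1 (R : realType) (alpha : R) :
  0 < alpha -> alpha < 1 / 32%:R ->
  exists (eps : R) (n0 : nat), 0 < eps /\
    forall (n : nat) (T : finType) (E : rel T),
      irreflexive E -> #|T| = (2 * n)%N -> (n0 <= n)%N ->
      ~ extremal E alpha n ->
      (1 - eps) * n%:R <= (min_semideg E)%:R ->
      has_antidirected_hamiltonian_cycle E.
Proof.
move=> alpha0 _.
(* The integer [p] exceeds [1 / alpha]. With [q = n %/ N] and [a = 96 * p * q], this [N] gives
   [a <= alpha * n] and, through [n <= 2 * N * q], also [48 * (n * q) <= a * a]. *)
pose p := (Num.bound alpha^-1).+1; pose N := (96 * (p * p))%N.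
have p_alpha : 1 <= alpha * p%:R.
  rewrite mulrC -ler_pdivrMr // mul1r ltW //.
  apply: lt_trans (archi_boundP _) _; first by rewrite invr_ge0 ltW.
  by rewrite ltr_nat.
have N0 : (0 < N)%N by [].
have [q0 hq0] := antidirected_hamiltonian N0.
exists N%:R^-1, (N * q0.+1)%N; split; first by rewrite invr_gt0 ltr0n.
move=> n T E _ cT nbig next deg.
pose q := (n %/ N)%N; pose a := (96 * (p * q))%N.
have qbig : (q0 < q)%N by rewrite /q leq_divRL // mulnC.
have Nqn : (N * q <= n)%N by rewrite mulnC leq_trunc_div.
have nNq : (n <= 2 * N * q)%N.
  have := ltn_ceil n N0; rewrite -/q mulSn mulnC => h.
  apply: leq_trans (ltnW h) _; have : (N <= N * q)%N by rewrite leq_pmulr // (leq_ltn_trans _ qbig).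
  by clear; lia.
have pq : (q <= p * q)%N by rewrite leq_pmull.
have q_pp : (96 * q <= N * q)%N by rewrite leq_mul2r /N leq_pmulr ?orbT.
have a_alpha : a%:R <= alpha * n%:R.
  apply: le_trans (_ : alpha * (N * q)%:R <= _); last by rewrite ler_pM2l // ler_nat.
  rewrite /a /N !natrM.
  have := ler_wpM2l (_ : 0 <= 96%:R * (p%:R * q%:R) :> R) p_alpha.
  rewrite mulr1 !mulr_ge0 // => /(_ isT) h; apply: le_trans h _.
  by rewrite le_eqVlt; apply/orP; left; apply/eqP; ring.
have low (m : nat) : (n <= m + a)%N -> (1 - alpha) * n%:R <= m%:R.
  rewrite mulrBl mul1r lerBlDr -(ler_nat R) natrD => h.
  by apply: le_trans h _; rewrite lerD2l.
have high (m : nat) : (m <= n)%N -> m%:R <= (1 + alpha) * n%:R.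
  rewrite -(ler_nat R) => h; apply: le_trans h _.
  by rewrite mulrDl mul1r lerDl mulr_ge0 // ltW.
(* The degree deficit is at most [n / N <= 2 * q]. *)
have semideg : (n <= min_semideg E + 2 * q)%N.
  rewrite -(ler_nat R) natrD -lerBlDr; apply: le_trans deg.
  rewrite mulrBl mul1r lerD2l lerN2 mulrC ler_pdivrMr ?ltr0n //.
  by rewrite -natrM ler_nat; move: nNq; clear; lia.
apply: (hq0 q n a T E) => //.
- exact: ltnW.
- by move: q_pp Nqn qbig; clear; lia.
- by move: pq; rewrite /a; clear; lia.
- have := leq_mul nNq (leqnn q); rewrite /N /a; clear; nia.
- by move=> x; have [h _] := min_semideg_le E x; move: h semideg; clear; lia.
- by move=> x; have [_ h] := min_semideg_le E x; move: h semideg; clear; lia.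
move=> A B A1 A2 B1 B2 oA iB; apply: next; exists A, B; split.
- by rewrite low ?high.
- by rewrite low ?high.
- by apply: le_trans a_alpha; rewrite ler_nat; apply/bigmax_leqP.
- by apply: le_trans a_alpha; rewrite ler_nat; apply/bigmax_leqP.
Qed.
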